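(* Let $K(m)$ be the cell-centered finite volume matrix defined in the context, with blocks $K_{HH}(m),K_{HL}(m),K_{LH}(m),K_{LL}(m)$, and let $S(m)=K_{LL}(m)-K_{LH}(m)K_{HH}(m)^{-1}K_{HL}(m)$ be the Schur complement of $K_{HH}(m)$ in $K(m)$. Then, as $m\to\infty$, (i) $K_{HH}(m)^{-1}=e_H\,\eta^{-1}e_H^T+\mathcal{O}(m^{-1})$; (ii) $S(m)=K_{LL}^\infty-(K_{L\Gamma}^\infty e_\Gamma)\,\eta^{-1}\,(e_\Gamma^TK_{\Gamma L}^\infty)+\mathcal{O}(m^{-1})$; (iii) $K_{LH}(m)K_{HH}(m)^{-1}=(K_{L\Gamma}^\infty e_\Gamma)\,\eta^{-1}e_H^T+\mathcal{O}(m^{-1})$.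
   Context: Grid and coefficient. The unit square $\Omega$ is divided into a fixed uniform $N\times N$ grid of square cells, one unknown per cell. Two cells are adjacent if they share an edge. The set of cells is partitioned as $H\cup L$ (disjoint), where $H$ is a nonempty edge-connected set of cells (the highly-diffusive island) none of which has an edge on $\partial\Omega$. For $m\ge 1$ let $\alpha_p=m$ if $p\in H$ and $\alpha_p=1$ if $p\in L$. Matrix. $K(m)$ is the symmetric positive definite matrix of the 5-point conservative finite volume discretization (harmonic averaging) of $-\nabla\cdot(\alpha\nabla u)=f$ with $u=0$ on $\partial\Omega$: for adjacent cells $p\neq q$, $[K(m)]_{pq}=-\frac{2\alpha_p\alpha_q}{\alpha_p+\alpha_q}$; for non-adjacent $p\ne q$, $[K(m)]_{pq}=0$; and $[K(m)]_{pp}=\sum_{q\text{ adjacent to }p}\frac{2\alpha_p\alpha_q}{\alpha_p+\alpha_q}+2\alpha_p\cdot\#\{\text{edges of }p\text{ on }\partial\Omega\}$. Thus the $H$–$H$ coupling is $m$, the $L$–$L$ coupling is $1$, and the $H$–$L$ coupling is $\overline h_m=\frac{2m}{m+1}$. Write $K(m)=\begin{bmatrix} K_{HH}(m) & K_{HL}(m) \\ K_{LH}(m) & K_{LL}(m) \end{bmatrix}$ according to $H\cup L$. Notation. $\Gamma\subset H$ is the set of cells of $H$ adjacent to some cell of $L$, and $I=H\setminus\Gamma$. Since cells of $I$ do not couple to $L$, $K_{LH}(m)=[\,0\;\;K_{L\Gamma}(m)\,]=K_{HL}(m)^T$ with columns ordered as $I,\Gamma$; $K_{\Gamma L}(m)=K_{L\Gamma}(m)^T$.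 A superscript $\infty$ denotes the entrywise limit as $m\to\infty$: $K_{LL}^\infty$, $K_{L\Gamma}^\infty$, $K_{\Gamma L}^\infty$ (these limits exist). With $n_H=|H|$, $e_H\in\mathbb{R}^{n_H}$ is the vector with all entries $n_H^{-1/2}$, written in blocks as $e_H^T=(e_I^T,e_\Gamma^T)$. Finally $\eta(m)=e_H^TK_{HH}(m)e_H$ and $\eta=\lim_{m\to\infty}\eta(m)>0$. $\mathcal O(m^{-1})$ denotes a matrix whose norm is at most a constant times $m^{-1}$ for all sufficiently large $m$, the constant being independent of $m$ (the grid, $H$ and $L$ are fixed). *)

(* Defs.v *)
From mathcomp Require Import all_boot all_order all_algebra.
From mathcomp Require Import boolp classical_sets reals.
From mathcomp Require Import topology normedtype.

Set Implicit Arguments.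
Unset Strict Implicit.
Unset Printing Implicit Defensive.

Import Order.TTheory GRing.Theory Num.Theory.
Import numFieldNormedType.Exports.

Local Open Scope ring_scope.

(* The cell (i, j) of the uniform N x N grid is [i/N, (i+1)/N] x [j/N, (j+1)/N]. *)
Definition cell (N : nat) : finType := ('I_N * 'I_N)%type.

Definition adjacent_index (i j : nat) : bool := (i.+1 == j) || (j.+1 == i).

Definition adjacent (N : nat) (p q : cell N) : bool :=
  ((p.1 == q.1) && adjacent_index p.2 q.2) ||
  ((p.2 == q.2) && adjacent_index p.1 q.1).

(* Number of edges of p on the boundary of the square, in the order left, right,
   bottom, top; the summands are Booleans coerced to nat. *)
Definition boundary_edges (N : nat) (p : cell N) : nat :=
  ((p.1 == 0 :> nat) + (p.1.+1 == N) + (p.2 == 0 :> nat) + (p.2.+1 == N))%N.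

(* Any two cells of A are joined by a path of adjacent cells staying inside A. *)
Definition edge_connected (N : nat) (A : {set cell N}) : Prop :=
  {in A &, forall p q : cell N,
    connect [rel x y | [&& x \in A, y \in A & adjacent x y]] p q}.

(* F(m) = O(m^-1) as m -> +oo. `|F m| is the largest absolute value of an entry;
   in a fixed dimension every other matrix norm is equivalent to it. *)
Definition bigO_inv (R : realType) (a b : nat) (F : R -> 'M[R]_(a, b)) : Prop :=
  exists C : R, (\forall m \near +oo, `|F m| <= C * m^-1)%classic.

Section FiniteVolume.
Variables (R : realType) (N : nat) (H : {set cell N}).

Definition Lset : {set cell N} := ~: H.

Definition Gamma : {set cell N} :=
  [set p in H | [exists q, (q \in Lset) && adjacent p q]]%SET.

Definition alpha (m : R) (p : cell N) : R := if p \in H then m else 1.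

Definition coupling (m : R) (p q : cell N) : R :=
  2 * alpha m p * alpha m q / (alpha m p + alpha m q).

Definition K_entry (m : R) (p q : cell N) : R :=
  if p == q then
    \sum_(r | adjacent p r) coupling m p r
      + 2 * alpha m p * (boundary_edges p)%:R
  else if adjacent p q then - coupling m p q
  else 0.

Definition K (m : R) : 'M[R]_#|{: cell N}| :=
  \matrix_(i, j) K_entry m (enum_val i) (enum_val j).

(* Rows and columns of every block are ordered by the enumeration of the
   corresponding set of cells. *)
Definition block (A B : {set cell N}) (M : 'M[R]_#|{: cell N}|) :
    'M[R]_(#|A|, #|B|) :=
  mxsub (fun i => enum_rank (enum_val i)) (fun j => enum_rank (enum_val j)) M.

Definition K_HH (m : R) := block H H (K m).
Definition K_HL (m : R) := block H Lset (K m).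
Definition K_LH (m : R) := block Lset H (K m).
Definition K_LL (m : R) := block Lset Lset (K m).
Definition K_LGamma (m : R) := block Lset Gamma (K m).
Definition K_GammaL (m : R) := (K_LGamma m)^T.

Definition schur (m : R) : 'M[R]_#|Lset| :=
  K_LL m - K_LH m *m invmx (K_HH m) *m K_HL m.

Definition lim_mx (a b : nat) (F : R -> 'M[R]_(a, b)) : 'M[R]_(a, b) :=
  \matrix_(i, j) lim (F m i j @[m --> +oo])%classic.

Definition K_LL_oo := lim_mx K_LL.
Definition K_LGamma_oo := lim_mx K_LGamma.
Definition K_GammaL_oo := lim_mx K_GammaL.

Definition e_H : 'cV[R]_#|H| := const_mx (Num.sqrt #|H|%:R)^-1.

(* The sub-vector of e_H on Gamma: it is normalized by #|H|, not by #|Gamma|. *)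
Definition e_Gamma : 'cV[R]_#|Gamma| := const_mx (Num.sqrt #|H|%:R)^-1.

Definition eta_ (m : R) : R := (e_H^T *m K_HH m *m e_H) 0 0.
Definition eta : R := lim (eta_ m @[m --> +oo])%classic.

End FiniteVolume.

Arguments K_LL_oo R {N} H.
Arguments K_LGamma_oo R {N} H.
Arguments K_GammaL_oo R {N} H.
Arguments e_H R {N} H.
Arguments e_Gamma R {N} H.
Arguments eta R {N} H.

(* Main.v *)
(* Up to O(1/m) the block K_HH(m) is m L + D, where L is the graph Laplacian of
   the island and D is diagonal with twice the number of neighbours outside the
   island. By connectedness the kernel of L consists of the constants, so the
   inverse of m L + D converges at rate 1/m to the inverse of its compression to
   the line spanned by e_H, which is e_H eta^-1 e_H^T with eta = e_H^T D e_H. The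
   island does not touch the boundary of the square, hence has a neighbour in L,
   and eta > 0. The blocks with an index in L converge at rate 1/m, so (ii) and
   (iii) follow from (i) by multiplication. *)

Require Import Defs.
From mathcomp Require Import all_boot all_order all_algebra.
From mathcomp Require Import boolp classical_sets reals.
From mathcomp Require Import topology normedtype.
From mathcomp Require Import ring lra.

Set Implicit Arguments.
Unset Strict Implicit.
Unset Printing Implicit Defensive.

Import Order.TTheory GRing.Theory Num.Theory.
Import numFieldNormedType.Exports.

Local Open Scope ring_scope.

(** * Calculus of bounds of order 1/m at infinity *)

Section BigO.
Variable R : realType.

(* [bigO_inv] for an arbitrary normed space, so that scalars and matrices of all
   sizes are treated at once. *)
Definition near_O (V : normedModType R) (f : R -> V) : Prop :=
  exists C : R, (\forall m \near +oo, `|f m| <= C * m^-1)%classic.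

Definition near_bounded (V : normedModType R) (f : R -> V) : Prop :=
  exists C : R, (\forall m \near +oo, `|f m| <= C)%classic.

Lemma near_eq_O (V : normedModType R) (f g : R -> V) :
  (\forall m \near +oo, f m = g m)%classic -> near_O g -> near_O f.
Proof.
move=> fg [C gC]; exists C; near=> m.
by rewrite (_ : f m = g m); near: m.
Unshelve. all: by end_near. Qed.

Lemma near_O0 (V : normedModType R) : near_O (fun=> 0 : V).
Proof. by exists 0; near=> m; rewrite normr0 mul0r.
Unshelve. all: by end_near. Qed.

Lemma near_OD (V : normedModType R) (f g : R -> V) :
  near_O f -> near_O g -> near_O (fun m => f m + g m).
Proof.
move=> [C fC] [D gD]; exists (C + D); near=> m.
rewrite mulrDl (le_trans (ler_normD _ _)) // lerD //; by near: m.
Unshelve. all: by end_near. Qed.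

Lemma near_ON (V : normedModType R) (f : R -> V) :
  near_O f -> near_O (fun m => - f m).
Proof. by move=> [C fC]; exists C; near=> m; rewrite normrN; near: m.
Unshelve. all: by end_near. Qed.

Lemma near_O_sum (V : normedModType R) (I : finType) (P : pred I)
    (f : I -> R -> V) :
  (forall i, P i -> near_O (f i)) -> near_O (fun m => \sum_(i | P i) f i m).
Proof.
move=> fO; suff H s : near_O (fun m => \sum_(i <- s | P i) f i m) by exact: H.
elim: s => [|i s IHs].
  by apply: near_eq_O (near_O0 V); near=> m; rewrite big_nil.
have [Pi|nPi] := boolP (P i).
  apply: near_eq_O (near_OD (fO i Pi) IHs).
  by near=> m; rewrite big_cons Pi.
by apply: near_eq_O IHs; near=> m; rewrite big_cons (negbTE nPi).
Unshelve. all: by end_near. Qed.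

Lemma near_O_bounded (V : normedModType R) (f : R -> V) (v : V) :
  near_O (fun m => f m - v) -> near_bounded f.
Proof.
(* The sign of [C] is unknown; its absolute value dominates C/m once m >= 1. *)
move=> [C fC]; exists (`|C| + `|v|); near=> m.
have m1 : 1 <= m by near: m; apply: nbhs_pinfty_ge; rewrite num_real.
rewrite -(subrK v (f m)) (le_trans (ler_normD _ _)) // lerD2r.
apply: (@le_trans _ _ (C * m^-1)); first by near: m.
apply: le_trans (ler_norm _) _; rewrite normrM ler_piMr //.
by rewrite ger0_norm ?invr_ge0 ?invf_le1 //; lra.
Unshelve. all: by end_near. Qed.

(** Used to evaluate [eta] and the entries of [lim_mx]: C/m <= e as soon as m >= C/e. *)
Lemma near_O_lim (f : R -> R) (l : R) :
  near_O (fun m => f m - l) -> lim (f m @[m --> +oo])%classic = l.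
Proof.
move=> [C fC]; apply: cvg_lim => //; apply/cvgrPdistC_le => e e0; near=> m.
have m0 : 0 < m by near: m; apply: nbhs_pinfty_gt; rewrite num_real.
apply: (@le_trans _ _ (C * m^-1)); first by near: m.
rewrite ler_pdivrMr // mulrC -ler_pdivrMr //.
by near: m; apply: nbhs_pinfty_ge; rewrite num_real.
Unshelve. all: by end_near. Qed.

Lemma mx_norm_entry (a b : nat) (M : 'M[R]_(a, b)) i j : `|M i j| <= `|M|.
Proof.
by rewrite [leRHS]/Num.Def.normr /= mx_normrE; apply/bigmax_geP; right => /=; exists (i, j).
Qed.

Lemma mx_norm_le (a b : nat) (M : 'M[R]_(a, b)) (c : R) :
  0 <= c -> (forall i j, `|M i j| <= c) -> `|M| <= c.
Proof.
move=> c0 Mc; rewrite [leLHS]/Num.Def.normr /= mx_normrE.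
by apply: bigmax_le => // -[i j] _ /=.
Qed.

(** The norm is the largest entry, and an entry of the product is a sum of [b] terms; hence the
    factor [b]. *)
Lemma mx_norm_mulmx (a b c : nat) (A : 'M[R]_(a, b)) (B : 'M[R]_(b, c)) :
  `|A *m B| <= b%:R * `|A| * `|B|.
Proof.
apply: mx_norm_le => [|i j]; first by rewrite !mulr_ge0.
rewrite mxE (le_trans (ler_norm_sum _ _ _)) //.
apply: (@le_trans _ _ (\sum_(k < b) `|A| * `|B|)).
  by apply: ler_sum => k _; rewrite normrM ler_pM // mx_norm_entry.
by rewrite sumr_const card_ord mulr_natl -mulrnAl.
Qed.

(** The largest entry is at most the sum of all absolute values, a finite sum of terms of order
    1/m. *)
Lemma bigO_inv_entries (a b : nat) (F : R -> 'M[R]_(a, b)) :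
  (forall i j, near_O (fun m => F m i j)) -> bigO_inv F.
Proof.
move=> FO.
suff: near_O (fun m => \sum_i \sum_j `|F m i j|).
  case=> C FC; exists C; near=> m.
  apply: le_trans (_ : \sum_i \sum_j `|F m i j| <= _); last first.
    by apply: le_trans (ler_norm _) _; near: m.
  apply: mx_norm_le => [|i j].
    by apply: sumr_ge0 => i _; apply: sumr_ge0.
  rewrite (bigD1 i) //= (bigD1 j) //= -addrA lerDl addr_ge0 ?sumr_ge0 //.
  by move=> k _; apply: sumr_ge0.
apply: near_O_sum => i _; apply: near_O_sum => j _.
have [C FC] := FO i j; exists C; near=> m; rewrite normr_id; by near: m.
Unshelve. all: by end_near. Qed.

Lemma lim_mx_bigO (a b : nat) (F : R -> 'M[R]_(a, b)) (M : 'M[R]_(a, b)) :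
  bigO_inv (fun m => F m - M) -> lim_mx F = M.
Proof.
move=> [C FC]; apply/matrixP => i j; rewrite mxE; apply: near_O_lim.
exists C; near=> m; apply: le_trans (_ : `|F m - M| <= _); last by near: m.
by have := mx_norm_entry (F m - M) i j; rewrite !mxE.
Unshelve. all: by end_near. Qed.

Lemma near_O_mulmx (a b c : nat) (F : R -> 'M[R]_(a, b)) (G : R -> 'M[R]_(b, c)) :
  near_O F -> near_bounded G -> near_O (fun m => F m *m G m).
Proof.
move=> [C FC] [D GD]; exists (b%:R * C * D); near=> m.
apply: le_trans (mx_norm_mulmx _ _) _.
have -> : b%:R * C * D * m^-1 = b%:R * (C * m^-1) * D by ring.
rewrite ler_pM ?mulr_ge0 ?ler_wpM2l //; by near: m.
Unshelve. all: by end_near. Qed.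

Lemma near_O_mulmxr (a b c : nat) (F : R -> 'M[R]_(a, b)) (G : R -> 'M[R]_(b, c)) :
  near_bounded F -> near_O G -> near_O (fun m => F m *m G m).
Proof.
move=> [C FC] [D GD]; exists (b%:R * C * D); near=> m.
apply: le_trans (mx_norm_mulmx _ _) _.
rewrite -[leRHS]mulrA ler_pM ?mulr_ge0 ?ler_wpM2l //; by near: m.
Unshelve. all: by end_near. Qed.

Lemma near_bounded_cst (V : normedModType R) (v : V) : near_bounded (fun=> v).
Proof. by exists `|v|; near=> m. Unshelve. all: by end_near. Qed.

(** Follows from F G - M N = (F - M) G + M (G - N), where G is bounded because it converges. *)
Lemma near_O_mulmxB (a b c : nat) (F : R -> 'M[R]_(a, b)) (G : R -> 'M[R]_(b, c))
    (M : 'M[R]_(a, b)) (N : 'M[R]_(b, c)) :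
  near_O (fun m => F m - M) -> near_O (fun m => G m - N) ->
  near_O (fun m => F m *m G m - M *m N).
Proof.
move=> FM GN.
apply: near_eq_O (near_OD (near_O_mulmx FM (near_O_bounded GN))
  (near_O_mulmxr (near_bounded_cst M) GN)).
by near=> m; rewrite mulmxBl mulmxBr addrA subrK.
Unshelve. all: by end_near. Qed.

Lemma near_O_trmx (a b : nat) (F : R -> 'M[R]_(a, b)) :
  near_O F -> near_O (fun m => (F m)^T).
Proof.
move=> [C FC]; exists C; near=> m; apply: le_trans (_ : `|F m| <= _).
  by apply: mx_norm_le => // i j; rewrite mxE mx_norm_entry.
by near: m.
Unshelve. all: by end_near. Qed.

Lemma near_O_inv_scale (V : normedModType R) (v : V) :
  near_O (fun m : R => m^-1 *: v).
Proof.
exists `|v|; near=> m; rewrite normrZ mulrC ler_wpM2l //.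
rewrite ger0_norm // invr_ge0.
by near: m; apply: nbhs_pinfty_ge; rewrite num_real.
Unshelve. all: by end_near. Qed.

End BigO.

Lemma near_O_entry (R : realType) (a b : nat) (F : R -> 'M[R]_(a, b)) i j :
  near_O F -> near_O (fun m => F m i j).
Proof.
move=> [C FC]; exists C; near=> m.
by apply: le_trans (mx_norm_entry _ _ _) _; near: m.
Unshelve. all: by end_near. Qed.

(** * Inverses of perturbed matrices *)

Lemma invmx_approx (R : realType) (n : nat) (A X E : R -> 'M[R]_n) :
  (\forall m \near +oo, A m *m X m = 1%:M + E m)%classic ->
  near_bounded X -> near_O E -> near_O (fun m => invmx (A m) - X m).
Proof.
move=> AX [C XC] EO.
have Esmall : (\forall m \near +oo, n%:R * `|E m| <= 2^-1)%classic.
  have [D ED] := EO; near=> m.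
  have m0 : 0 < m by near: m; apply: nbhs_pinfty_gt; rewrite num_real.
  apply: (@le_trans _ _ (n%:R * (D * m^-1))).
    by rewrite ler_wpM2l //; near: m.
  rewrite mulrA ler_pdivrMr // [leRHS]mulrC -ler_pdivrMr ?invr_gt0 ?ltr0n //.
  by near: m; apply: nbhs_pinfty_ge; rewrite num_real.
have EM k (M : 'M[R]_(k, n)) (N : 'M[R]_n) :
    n%:R * `|N| <= 2^-1 -> `|M *m N| <= `|M| * 2^-1.
  move=> N2; apply: le_trans (mx_norm_mulmx _ _) _.
  by rewrite mulrAC mulrC ler_wpM2l.
(* If Z A = 0, then 0 = Z A X = Z + Z E, so |Z| = |Z E| <= |Z|/2 and Z = 0. This is applied to Z =
   [kermx (A m)]. *)
have Aunit : (\forall m \near +oo, A m \in unitmx)%classic.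
  near=> m; rewrite -row_free_unit -kermx_eq0 -normr_le0.
  have AXE : A m *m X m = 1%:M + E m by near: m.
  have /(EM _ (kermx (A m))) : n%:R * `|E m| <= 2^-1 by near: m.
  have -> : kermx (A m) *m E m = - kermx (A m).
    apply/eqP; rewrite -addr_eq0 addrC; apply/eqP.
    by rewrite -[X in X + _]mulmx1 -mulmxDr -AXE mulmxA mulmx_ker mul0mx.
  by rewrite normrN; lra.
have AK : (\forall m \near +oo, invmx (A m) - X m = - (invmx (A m) *m E m))%classic.
  near=> m; have AXE : A m *m X m = 1%:M + E m by near: m.
  have <- : invmx (A m) *m (A m *m X m) = X m.
    by rewrite mulmxA mulVmx ?mul1mx //; near: m.
  by rewrite AXE mulmxDr mulmx1 opprD addrA subrr add0r.
apply: (near_eq_O AK); apply: near_ON; apply: near_O_mulmxr EO.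
(* The bound 2C comes from absorption: |A^-1| <= |X| + |A^-1 E| <= C + |A^-1|/2. *)
exists (2 * C); near=> m.
have /(EM _ (invmx (A m))) E2 : n%:R * `|E m| <= 2^-1 by near: m.
have XC' : `|X m| <= C by near: m.
have : `|invmx (A m)| <= `|X m| + `|invmx (A m) *m E m|.
  rewrite -[X in `|X| <= _](subrK (X m)) addrC.
  have -> : invmx (A m) - X m = - (invmx (A m) *m E m) by near: m.
  by rewrite -(normrN (_ *m _)) ler_normD.
lra.
Unshelve. all: by end_near. Qed.

(** The columns of [cokermx L] lie in the kernel of [L], hence are multiples of [e], and [B^T] kills
    them. Row-space inclusion thus gives a factorization of [B^T] through [L], and symmetry lets it
    be transposed. *)
Lemma sym_range (F : fieldType) (n k : nat) (L : 'M[F]_n) (e : 'cV[F]_n)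
    (B : 'M[F]_(n, k)) :
  L^T = L -> (forall v : 'cV_n, L *m v = 0 -> exists c, v = c *: e) ->
  e^T *m B = 0 -> exists Q, B = L *m Q.
Proof.
move=> Lsym Lker eB.
have /submxP[Q BQ] : (B^T <= L)%MS.
  rewrite submxE; apply/eqP/matrixP => i j; rewrite [RHS]mxE.
  have [|c cE] := Lker (col j (cokermx L)).
    by rewrite colE mulmxA mulmx_coker mul0mx.
  transitivity ((B^T *m col j (cokermx L)) i 0).
    by rewrite colE mulmxA -colE [RHS]mxE.
  by rewrite cE -scalemxAr -[e]trmxK -trmx_mul eB trmx0 scaler0 mxE.
by exists Q^T; rewrite -[B]trmxK BQ trmx_mul Lsym.
Qed.

(* Writing P for the limit, the symmetric L has range the orthogonal complement
   of e, which contains the columns of 1 - D P; a solution Q of L Q = 1 - D P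
   makes P + Q / m an inverse of m L + D up to O(1/m). *)
Lemma invmx_singular_perturbation (R : realType) (n : nat) (L D : 'M[R]_n)
    (e : 'cV[R]_n) (A : R -> 'M[R]_n) (c := (e^T *m D *m e) 0 0) :
  L^T = L -> L *m e = 0 ->
  (forall v : 'cV_n, L *m v = 0 -> exists a, v = a *: e) -> c != 0 ->
  near_O (fun m => A m - (m *: L + D)) ->
  near_O (fun m => invmx (A m) - c^-1 *: (e *m e^T)).
Proof.
move=> Lsym Le Lker c0 AO; set P := c^-1 *: (e *m e^T).
(* Solvable since e^T D P = c^-1 (e^T D e) e^T = e^T. *)
have [Q LQ] : exists Q, 1%:M - D *m P = L *m Q.
  apply: sym_range Lsym Lker _; rewrite mulmxBr mulmx1 -scalemxAr -scalemxAr.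
  by rewrite !mulmxA [e^T *m D *m e]mx11_scalar -/c mul_scalar_mx scalerA
    mulVf // scale1r subrr.
pose X m := P + m^-1 *: Q.
have XP : near_O (fun m => X m - P).
  apply: near_eq_O (near_O_inv_scale Q).
  by near=> m; rewrite /X addrC addKr.
apply: (near_eq_O (g := fun m => (invmx (A m) - X m) + (X m - P))).
  by near=> m; rewrite addrA subrK.
(* Expanding, (m L + D)(P + Q/m) = m L P + (L Q + D P) + D Q/m = 1 + D Q/m, because L P = 0. The
   other term of [E] accounts for A - (m L + D). *)
apply: (near_OD _ XP); pose E m := (A m - (m *: L + D)) *m X m + m^-1 *: (D *m Q).
apply: (@invmx_approx _ _ A X E).
- near=> m; have m0 : m != 0.
    by apply: lt0r_neq0; near: m; apply: nbhs_pinfty_gt; rewrite num_real.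
  rewrite -{1}(subrK (m *: L + D) (A m)) mulmxDl /E [RHS]addrCA; congr (_ + _).
  rewrite mulmxDl /X !mulmxDr -!scalemxAl -!scalemxAr.
  rewrite !(mulmxA L) Le mul0mx !scaler0 add0r scalerA mulfV // scale1r -LQ.
  by rewrite addrA -scalemxAr subrK.
- exact: near_O_bounded XP.
- apply: near_OD (near_O_inv_scale _).
  exact: near_O_mulmx AO (near_O_bounded XP).
Unshelve. all: by end_near. Qed.

(** * Graph Laplacians and their kernel *)

Section Laplacian.
Variables (R : realDomainType) (n : nat) (a : rel 'I_n).

Definition laplacian : 'M[R]_n :=
  \matrix_(i, j) ((\sum_k (a i k)%:R) *+ (i == j) - (a i j)%:R).

Lemma laplacian_mulE (v : 'cV[R]_n) i :
  (laplacian *m v) i 0 = \sum_k (a i k)%:R * (v i 0 - v k 0).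
Proof.
rewrite mxE; under eq_bigr do rewrite mxE mulrBl.
under [RHS]eq_bigr do rewrite mulrBr.
rewrite !sumrB; congr (_ - _); rewrite (bigD1 i) //= eqxx mulr1n [X in _ + X]big1 ?addr0.
  by rewrite mulr_suml.
by move=> j ji; rewrite eq_sym (negbTE ji) mulr0n mul0r.
Qed.

Lemma laplacian_const (c : R) : laplacian *m (const_mx c : 'cV_n) = 0.
Proof.
apply/colP => i; rewrite laplacian_mulE [RHS]mxE big1 // => k _.
by rewrite !mxE subrr mulr0.
Qed.

Lemma laplacian_trmx : symmetric a -> laplacian^T = laplacian.
Proof.
move=> asym; apply/matrixP => i j; rewrite !mxE asym; congr (_ - _).
by have [->|] := eqVneq i j.
Qed.

(* Maximum principle: the neighbours of a maximum of v are maxima too. *)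
Lemma laplacian_ker (v : 'cV[R]_n) :
  (forall i j, connect a i j) -> laplacian *m v = 0 ->
  forall i j, v i 0 = v j 0.
Proof.
move=> aconn Lv i j; pose s := [arg max_(k > i) v k 0]%O.
have smax k : v k 0 <= v s 0 by rewrite /s; case: arg_maxP => // l _; apply.
suff vs k : v k 0 = v s 0 by rewrite !vs.
have /connectP[p] := aconn s k; elim/last_ind: p k => [|p x IHp] k /=.
  by move=> _ ->.
rewrite rcons_path last_rcons => /andP[sp ax] ->.
have {IHp} vp := IHp _ sp erefl.
(* At the maximum [last s p] this row is a sum of nonnegative terms equal to 0, so the term of the
   neighbour [x] vanishes. *)
have := laplacian_mulE v (last s p); rewrite Lv mxE => /esym.
move/psumr_eq0P => /(_ _ x isT); rewrite ax mul1r vp => vx.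
apply/esym/eqP; rewrite -subr_eq0; apply/eqP/vx => l _.
by rewrite mulr_ge0 // subr_ge0.
Qed.

End Laplacian.

(** * Adjacency of grid cells *)

Lemma adjacent_sym (N : nat) : symmetric (@adjacent N).
Proof.
move=> p q; rewrite /adjacent /adjacent_index (eq_sym p.1) (eq_sym p.2).
by rewrite (orbC (p.2.+1 == _)) (orbC (p.1.+1 == _)).
Qed.

Lemma adjacent_irrefl (N : nat) : irreflexive (@adjacent N).
Proof. by move=> p; rewrite /adjacent /adjacent_index !gtn_eqF // !andbF. Qed.

(* A cell of H of maximal first coordinate has a neighbour outside H. *)
Lemma island_exit (N : nat) (H : {set cell N}) :
  H != finset.set0 -> (forall p, p \in H -> boundary_edges p = 0%N) ->
  exists p q, [/\ p \in H, q \notin H & adjacent p q].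
Proof.
move=> /finset.set0Pn[p0 p0H] Hint.
pose p := [arg max_(r > p0 in H) (r.1 : nat)]%N.
have [pH pmax] : p \in H /\ forall r, r \in H -> (r.1 <= p.1)%N.
  by rewrite /p; case: arg_maxnP.
have pN : (p.1.+1 < N)%N.
  rewrite ltn_neqAle ltn_ord andbT; apply/eqP => pE; have /eqP := Hint _ pH.
  by rewrite /boundary_edges pE eqxx !addn_eq0 /= !andbF.
exists p, (Ordinal pN, p.2); split => //.
  by apply: contraTN isT => /pmax /=; rewrite ltnn.
by rewrite /adjacent /adjacent_index /= eqxx eqxx orbT.
Qed.

(** * Convergence of the matrix entries with an index in L *)

Section Island.
Variables (R : realType) (N : nat) (H : {set cell N}).

Lemma blockE (A B : {set cell N}) (m : R) i j :
  block A B (K H m) i j = K_entry H m (enum_val i) (enum_val j).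
Proof. by rewrite !mxE !enum_rankK. Qed.

Lemma in_Lset p : (p \in Lset H) = (p \notin H).
Proof. exact: finset.in_setC. Qed.

Lemma couplingC (m : R) p q : coupling H m p q = coupling H m q p.
Proof. by rewrite /coupling (mulrAC 2) addrC. Qed.

(* Limit of [coupling] for cells not both in H; a junk value otherwise. *)
Definition coupling_oo (p q : cell N) : R :=
  if (p \in H) || (q \in H) then 2 else 1.

Lemma near_O_coupling p q : ~~ ((p \in H) && (q \in H)) ->
  near_O (fun m => coupling H m p q - coupling_oo p q).
Proof.
wlog qH : p q / q \notin H => [hw|_].
  rewrite negb_and => /orP[pH|qH].
    rewrite /coupling_oo orbC; under [X in near_O X]eq_fun do rewrite couplingC.
    by apply: hw; rewrite // negb_and pH orbT.
  by apply: hw; rewrite // negb_and qH orbT.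
rewrite /coupling /coupling_oo /alpha (negbTE qH) orbF.
case: ifP => pH; last first.
  by apply: near_eq_O (near_O0 _); near=> m; field.
(* The constant 2 comes from 2m/(m+1) - 2 = -2/(m+1). *)
exists 2; near=> m.
have m0 : 0 < m by near: m; apply: nbhs_pinfty_gt; rewrite num_real.
have -> : 2 * m * 1 / (m + 1) - 2 = - (2 / (m + 1)) by field; lra.
rewrite normrN ger0_norm ?divr_ge0 //; last lra.
by rewrite ler_pM2l // lef_pV2 ?posrE //; lra.
Unshelve. all: by end_near. Qed.

(* Likewise meaningful only for cells not both in H. *)
Definition K_entry_oo (p q : cell N) : R :=
  if p == q then
    \sum_(r | adjacent p r) coupling_oo p r + 2 * (boundary_edges p)%:R
  else if adjacent p q then - coupling_oo p q
  else 0.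

Lemma near_O_K_entry p q : ~~ ((p \in H) && (q \in H)) ->
  near_O (fun m => K_entry H m p q - K_entry_oo p q).
Proof.
move=> pqH; rewrite /K_entry /K_entry_oo; case: eqP => [pq|_].
  (* On the diagonal [p] lies outside [H], so its boundary term does not depend on [m] and only the
     couplings contribute to the error. *)
  have pH : p \notin H by move: pqH; rewrite -pq andbb.
  apply: near_eq_O (near_O_sum
    (f := fun r m => coupling H m p r - coupling_oo p r)
    (P := fun r => adjacent p r) _).
    near=> m; rewrite sumrB /alpha (negbTE pH); ring.
  by move=> r _; apply: near_O_coupling; rewrite negb_and pH.
case: ifP => _.
  apply: near_eq_O (near_ON (near_O_coupling pqH)).
  by near=> m; rewrite opprB opprK addrC.
by apply: near_eq_O (near_O0 _); near=> m; rewrite subrr.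
Unshelve. all: by end_near. Qed.

Definition K_oo (A B : {set cell N}) : 'M[R]_(#|A|, #|B|) :=
  \matrix_(i, j) K_entry_oo (enum_val i) (enum_val j).

Lemma near_O_block_L (B : {set cell N}) :
  bigO_inv (fun m => block (Lset H) B (K H m) - K_oo (Lset H) B).
Proof.
apply: bigO_inv_entries => i j.
have pqH : ~~ ((enum_val i \in H) && (enum_val j \in H)).
  by rewrite negb_and -in_Lset enum_valP.
apply: near_eq_O (near_O_K_entry pqH).
by near=> m; rewrite mxE blockE !mxE.
Unshelve. all: by end_near. Qed.

Lemma K_entryC (m : R) p q : K_entry H m p q = K_entry H m q p.
Proof.
rewrite /K_entry adjacent_sym couplingC eq_sym.
by case: eqP => // ->.
Qed.

Lemma K_HL_trmx (m : R) : K_HL H m = (K_LH H m)^T.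
Proof. by apply/matrixP => i j; rewrite [RHS]mxE !blockE K_entryC. Qed.

(* Cells of H outside Gamma do not couple to L. *)
Lemma K_oo_Gamma :
  K_oo (Lset H) (Gamma H) *m e_Gamma R H = K_oo (Lset H) H *m e_H R H.
Proof.
apply/colP => i; rewrite !mxE.
under eq_bigr do rewrite !mxE.
under [RHS]eq_bigr do rewrite !mxE.
set p := enum_val i; set c := _^-1.
have pL : p \notin H by rewrite -in_Lset enum_valP.
rewrite -(big_enum_val (fun q => K_entry_oo p q * c)).
rewrite -(big_enum_val (fun q => K_entry_oo p q * c)).
rewrite [RHS](bigID (mem (Gamma H))) /= [X in _ = _ + X]big1 ?addr0.
  by apply: eq_bigl => q; rewrite !finset.inE andbA andbb.
move=> q /andP[qH qG]; rewrite /K_entry_oo; case: eqP => [pq|_].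
  by rewrite pq qH in pL.
case: ifP => [pq|]; last by rewrite mul0r.
case/negP: qG; rewrite finset.inE qH; apply/existsP; exists p.
by rewrite in_Lset pL adjacent_sym.
Qed.

(** * The island block and the limit energy *)

Definition adjacent_H : rel 'I_#|H| :=
  fun i j => adjacent (enum_val i) (enum_val j).

Lemma connect_adjacent_H : edge_connected H -> forall i j, connect adjacent_H i j.
Proof.
move=> Hconn i j; have /connectP[s] := Hconn _ _ (enum_valP i) (enum_valP j).
elim: s i => [|q s IHs] i /=; first by move=> _ /enum_val_inj->.
case/andP=> /and3P[_ qH iq]; rewrite -(enum_rankK_in qH qH) => qs js.
apply: connect_trans (connect1 _) (IHs _ qs js).
by rewrite /adjacent_H enum_rankK_in.
Qed.

Definition exits (p : cell N) : R := \sum_(r | adjacent p r && (r \notin H)) 1.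

(** The factor 2 is the limit of the coupling 2m/(m+1) between [H] and its complement. *)
Definition D_oo : 'M[R]_#|H| := diag_mx (\row_i (2 * exits (enum_val i))).

(** Couplings inside [H] equal [m] exactly, so the error [f] is diagonal and comes only from the
    couplings that leave the island. *)
Lemma near_O_K_HH : (forall p, p \in H -> boundary_edges p = 0%N) ->
  near_O (fun m => K_HH H m - (m *: laplacian R adjacent_H + D_oo)).
Proof.
move=> Hint; apply: bigO_inv_entries => i j.
set p : cell N := enum_val i.
have pH : p \in H := enum_valP i.
pose f m : R := (\sum_(r | adjacent p r && (r \notin H))
  (coupling H m p r - coupling_oo p r)) *+ (i == j).
apply: (near_eq_O (g := f)); last first.
  apply: near_eq_O (near_O_sum (f := fun r m =>
    (coupling H m p r - coupling_oo p r) *+ (i == j)) _).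
    by near=> m; rewrite sumrMnl.
  move=> r /andP[_ rH]; have [_|_] := eqVneq i j; last exact: near_O0.
  by apply: near_O_coupling; rewrite negb_and rH orbT.
near=> m; have m0 : 0 < m by near: m; apply: nbhs_pinfty_gt; rewrite num_real.
have cHH q : q \in H -> coupling H m p q = m.
  by move=> qH; rewrite /coupling /alpha pH qH; field; lra.
rewrite /K_HH mxE blockE !mxE -/p /K_entry (inj_eq enum_val_inj) /f.
have [<-|ij] := eqVneq i j; last first.
  rewrite !mulr0n sub0r addr0 /adjacent_H -/p.
  case: ifP => _; last by rewrite /= mulr0n; ring.
  by rewrite cHH ?enum_valP //= mulr1n; ring.
rewrite !mulr1n /adjacent_H -/p adjacent_irrefl subr0 Hint // mulr0 addr0.
(* Neighbours inside [H] give [m] times the degree in the island graph; those outside give the error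
   plus the diagonal entry of [D_oo]. *)
rewrite (bigID (mem H)) /= sumrB.
under eq_bigr => q /andP[_ qH] do rewrite cHH //.
rewrite -(big_enum_val (fun q => (adjacent p q)%:R)) /= mulr_sumr.
rewrite /exits mulr_sumr.
under [X in _ = _ - X]eq_bigr do rewrite /coupling_oo pH /=.
under [X in _ - (_ + X) = _]eq_bigr do rewrite mulr1.
set S := \sum_(_ | _) coupling _ _ _ _; set T := \sum_(_ | _) 2.
suff -> : \sum_(r | adjacent p r && (r \in H)) m =
    \sum_(r in H) m * (adjacent p r)%:R by ring.
rewrite big_mkcondl; apply: eq_bigr => r _.
by case: adjacent; rewrite ?mulr1 ?mulr0.
Unshelve. all: by end_near. Qed.

Lemma sqrt_cardH_gt0 : H != finset.set0 -> 0 < (Num.sqrt #|H|%:R : R)^-1.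
Proof. by move=> Hn; rewrite invr_gt0 sqrtr_gt0 ltr0n card_gt0. Qed.

(** The energy is a sum of nonnegative terms over [H], and a cell with a neighbour outside [H]
    contributes a positive one. *)
Lemma D_oo_energy_gt0 : H != finset.set0 ->
  (forall p, p \in H -> boundary_edges p = 0%N) ->
  0 < ((e_H R H)^T *m D_oo *m e_H R H) 0 0.
Proof.
move=> Hn Hint; have c0 := sqrt_cardH_gt0 Hn; set c := _^-1 in c0.
have [p [q [pH qH pq]]] := island_exit Hn Hint.
rewrite mul_mx_diag mxE.
under eq_bigr do rewrite !mxE -/c.
rewrite -(big_enum_val (fun r => c * (2 * exits r) * c)) /=.
have ex0 r : 0 <= exits r by apply: sumr_ge0.
rewrite (bigD1 p) //= ltr_pwDl //; last first.
  by apply: sumr_ge0 => r _; rewrite !mulr_ge0 // ltW.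
rewrite !mulr_gt0 // /exits (bigD1 q) ?pq //=.
by rewrite ltr_pwDl // sumr_ge0.
Qed.

(** The growing term m e^T L e vanishes because [e_H] is constant, which leaves the energy of
    [D_oo]. *)
Lemma etaE : (forall p, p \in H -> boundary_edges p = 0%N) ->
  eta R H = ((e_H R H)^T *m D_oo *m e_H R H) 0 0.
Proof.
move=> Hint; apply: near_O_lim; set e := e_H R H.
apply: near_eq_O (near_O_entry 0 0 (near_O_mulmx (near_O_mulmxr
  (near_bounded_cst e^T) (near_O_K_HH Hint)) (near_bounded_cst e))).
near=> m; rewrite /eta_ -/e mulmxBr mulmxDr mulmxBl mulmxDl.
rewrite -scalemxAr -scalemxAl -(mulmxA _ (laplacian _ _)) laplacian_const.
by rewrite mulmx0 scaler0 add0r [RHS]mxE [X in _ = _ + X]mxE.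
Unshelve. all: by end_near. Qed.

End Island.

(** * Assembly of the three expansions *)

Theorem lemma3 (R : realType) (N : nat) (H : {set cell N})
    (H_nonempty : H != finset.set0)
    (H_connected : edge_connected H)
    (H_interior : forall p : cell N, p \in H -> boundary_edges p = 0%N) :
  [/\ bigO_inv (fun m : R =>
         invmx (K_HH H m)
           - (eta R H)^-1 *: (e_H R H *m (e_H R H)^T)),
      bigO_inv (fun m : R =>
         schur H m
           - (K_LL_oo R H
                - (eta R H)^-1 *: ((K_LGamma_oo R H *m e_Gamma R H)
                    *m ((e_Gamma R H)^T *m K_GammaL_oo R H))))
    & bigO_inv (fun m : R =>
         K_LH H m *m invmx (K_HH H m)
           - (eta R H)^-1 *: ((K_LGamma_oo R H *m e_Gamma R H)
               *m (e_H R H)^T))].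
Proof.
have LLoo : K_LL_oo R H = K_oo R H (Lset H) (Lset H).
  exact/lim_mx_bigO/near_O_block_L.
have LGoo : K_LGamma_oo R H = K_oo R H (Lset H) (Gamma H).
  exact/lim_mx_bigO/near_O_block_L.
have GLoo : K_GammaL_oo R H = (K_oo R H (Lset H) (Gamma H))^T.
  apply/lim_mx_bigO; apply: near_eq_O (near_O_trmx (near_O_block_L R H (Gamma H))).
  by near=> m; rewrite [RHS]linearB.
set e := e_H R H; set c := eta R H.
have invO : near_O (fun m => invmx (K_HH H m) - c^-1 *: (e *m e^T)).
  rewrite /c etaE //; apply: (invmx_singular_perturbation
    (L := laplacian R (@adjacent_H N H))).
  - by apply: laplacian_trmx => i j; apply: adjacent_sym.
  - exact: laplacian_const.
  - move=> v Lv; have vE := laplacian_ker (connect_adjacent_H H_connected) Lv.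
    have /finset.set0Pn[p pH] := H_nonempty.
    (* A kernel vector is constant; the square root undoes the normalization of [e_H]. *)
    exists (v (enum_rank_in pH p) 0 * Num.sqrt #|H|%:R).
    apply/colP => i; rewrite !mxE -mulrA mulfV ?mulr1; first exact: vE.
    by rewrite -invr_eq0 gt_eqF // sqrt_cardH_gt0.
  - by rewrite gt_eqF // D_oo_energy_gt0.
  - exact: near_O_K_HH.
pose KL := K_oo R H (Lset H) H.
have LHO : near_O (fun m => K_LH H m - KL) by exact: near_O_block_L.
have prodO : near_O (fun m =>
    K_LH H m *m invmx (K_HH H m) - KL *m (c^-1 *: (e *m e^T))).
  exact: near_O_mulmxB LHO invO.
have HLO : near_O (fun m => K_HL H m - KL^T).
  apply: near_eq_O (near_O_trmx LHO).
  by near=> m; rewrite K_HL_trmx [RHS]linearB.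
(* Replacing the limit block on [Gamma] applied to [e_Gamma] by [KL *m e] turns the claimed limits
   into products of the limits of the factors. *)
rewrite LLoo LGoo GLoo -trmx_mul K_oo_Gamma -/KL -/e; split => //.
- apply: near_eq_O (near_OD (near_O_block_L R H (Lset H))
    (near_ON (near_O_mulmxB prodO HLO))).
  near=> m; rewrite /schur /K_LL -scalemxAr -scalemxAl trmx_mul !mulmxA.
  by rewrite !opprD !opprK addrACA.
- apply: near_eq_O prodO; near=> m.
  by rewrite -scalemxAr mulmxA.
Unshelve. all: by end_near. Qed.
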